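(* Let $G$ be a squareful group of infinite order $\kappa$. Then $G$ has a strong complete mapping.
   Context: An infinite group $G$ is squareful if $|\{g^2:g\in G\}|=|G|$. A bijection $\theta:G\to G$ is a strong complete mapping if both $g\mapsto g^{-1}\theta(g)$ and $g\mapsto g\,\theta(g)$ are bijections of $G$. *)

(* Defs.v *)
From mathcomp Require Import all_boot.
From mathcomp Require Import boolp classical_sets functions cardinality.

Set Implicit Arguments.
Unset Strict Implicit.
Unset Printing Implicit Defensive.

Local Open Scope group_scope.
Local Open Scope classical_set_scope.
Local Open Scope card_scope.

(* The order of an abstract [G : groupType] is the cardinality of [[set: G]];
   cardinals are compared through [#=] (existence of a bijection). *)
Definition squareful (G : groupType) : Prop :=
  infinite_set [set: G] /\ [set g ^+ 2 | g in [set: G]] #= [set: G].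

Definition strong_complete_mapping (G : groupType) (theta : G -> G) : Prop :=
  [/\ bijective theta,
      bijective (fun g : G => g^-1 * theta g)
    & bijective (fun g : G => g * theta g)].

(* Main.v *)
(** The graph of a strong complete mapping is a set of pairs (g, h) on which each
of the four maps g, h, g^-1 h and g h takes every value exactly once.  Such a set
is built by transfinite recursion along a well-order of G * {four maps} of minimal
type: at stage (y, i) a pair with i-th value y is added, unless one is already
there.  The fibre of the i-th map over y contains |G| pairs on which the three
other maps are injective, and fewer than |G| values are used up, so there is a
pair all of whose values are new.  For the maps g and h the fibres are full
copies of G; for g^-1 h and g h the remaining map is g^2 up to translation and
inversion, and g is restricted to a set of square roots, one for each square:
there are |G| of them because G is squareful. *)

Require Import Defs.
From mathcomp Require Import all_boot.
From mathcomp Require Import boolp classical_sets functions cardinality wochoice.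

Lemma well_founded_min (A : Type) (r : A -> A -> Prop) (P : A -> Prop) :
  well_founded r -> (exists a, P a) ->
  exists2 a, P a & forall b, r b a -> ~ P b.
Proof.
move=> rwf [a Pa]; elim/(well_founded_ind rwf): a Pa => a IH Pa.
have [[b rba Pb]|noP] := pselect (exists2 b, r b a & P b); first exact: IH Pb.
by exists a => // b rba Pb; apply: noP; exists b.
Qed.

(** The step is only a relation [Q], so a witness is chosen for every possible history before the
    recursion is run. *)
Lemma well_founded_choice (A P : Type) (r : A -> A -> Prop)
    (Q : forall a, (forall b, r b a -> P) -> P -> Prop) :
  well_founded r -> (forall a rec, exists p, Q a rec p) ->
  exists t : A -> P, forall a, Q a (fun b _ => t b) (t a).
Proof.
move=> rwf exQ; pose F a rec := projT1 (cid (exQ a rec)).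
exists (Fix rwf (fun=> P) F) => a; rewrite Fix_eq.
  exact: projT2 (cid (exQ a _)).
move=> b g h gh; congr F.
by apply/functional_extensionality_dep => c; apply/funext.
Qed.

Lemma exists_strict_well_order (K : eqType) :
  exists r : K -> K -> Prop,
    well_founded r /\ forall x y, [\/ r x y, x = y | r y x].
Proof.
have [R woR] := well_ordering_principle K.
have Ranti := wo_chain_antisymmetric (withinW woR).
exists (fun x y => ~~ R y x); split=> [x|x y].
  apply: contrapT => nAx.
  have [|z [[/asboolP nAz minz] _]] :=
      woR [pred z | `[< ~ Acc (fun x y => ~~ R y x) z >]].
    by exists x; apply/asboolP.
  apply: nAz; split=> y; apply: contraNP => nAy.
  by apply: minz; apply/asboolP.
have [Ryx|] := boolP (R y x); last by constructor 1.
have [Rxy|] := boolP (R x y); last by constructor 3.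
by constructor 2; apply: Ranti => //; rewrite Rxy.
Qed.

Lemma infinite_set_noninjective (K : Type) (I : finType) (f : K -> I) :
  infinite_set [set: K]%classic -> ~ injective f.
Proof.
move=> Kinf finj; apply: Kinf; rewrite -(preimage_setT f).
by apply: finite_preimage => // x y _ _ /finj.
Qed.

(* The factor [I] spares the proof that [A * I] has the cardinality of [A] for
   infinite [A] and finite nonempty [I]. *)
Definition dominated_below {K : Type} (r : K -> K -> Prop) (a : K) : Prop :=
  exists (I : finType) (phi : K -> K * I),
    injective phi /\ forall k, r (phi k).1 a.

Lemma exists_initial_well_order (K : eqType) :
  infinite_set [set: K]%classic ->
  exists r : K -> K -> Prop,
    [/\ well_founded r, forall x y, [\/ r x y, x = y | r y x]
      & forall a, ~ dominated_below r a].
Proof.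
move=> Kinf; have [r [rwf rtot]] := exists_strict_well_order K.
have [big|nobig] := pselect (exists a, dominated_below r a); last first.
  by exists r; split=> // a abig; apply: nobig; exists a.
have [a [I [phi [phi_inj phi_a]]] amin] := well_founded_min _ _ _ rwf big.
(* [phi] embeds [K] in (initial segment of [a]) * [I]; by minimality of [a] the
   lexicographic order pulled back along [phi] has no dominated element. *)
pose r' j k := r (phi j).1 (phi k).1 \/
  (phi j).1 = (phi k).1 /\ enum_rank (phi j).2 < enum_rank (phi k).2.
exists r'; split.
(* Lexicographic accessibility: induction on the first component, then on a bound [n] for the rank
   of the second. *)
- suff H b n k : (phi k).1 = b -> enum_rank (phi k).2 < n -> Acc r' k.
    by move=> k; apply: (H _ (enum_rank (phi k).2).+1 k erefl).
  elim: (rwf b) n k => {}b _ IHb; elim=> [k _|n IHn k kb kn]; first by rewrite ltn0.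
  split=> j [|[jk ltjk]]; first by rewrite kb => /IHb H; apply: H (ltnSn _).
  by apply: IHn; [rewrite jk|apply: leq_trans ltjk _].
- move=> x y; have [||] := rtot (phi x).1 (phi y).1; rewrite /r'.
  + by constructor 1; left.
  + move=> e; have [lt|lt|/ord_inj/enum_rank_inj e2] :=
      ltngtP (enum_rank (phi x).2) (enum_rank (phi y).2).
    * by constructor 1; right.
    * by constructor 3; right.
    * constructor 2; apply: phi_inj.
      by rewrite [LHS]surjective_pairing e e2 -surjective_pairing.
  + by constructor 3; left.
move=> k0 [J [psi [psi_inj psi_k0]]].
(* Minimality of [a] is contradicted by showing [b] dominated: every [(phi (psi k).1).1] is below or
   equal to [b], and [chi] keeps the finite rest of the data. *)
set b := (phi k0).1.
pose chi k := ((psi k).2, (phi (psi k).1).2).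
have chi_inj j k : (phi (psi j).1).1 = (phi (psi k).1).1 -> chi j = chi k -> j = k.
  move=> e1 [e2 e3]; apply: psi_inj.
  rewrite [LHS]surjective_pairing [RHS]surjective_pairing.
  congr pair => //; apply: phi_inj.
  by rewrite [LHS]surjective_pairing [RHS]surjective_pairing e1 e3.
(* If nothing is below [b], all these first components equal [b] and [chi] embeds [K] in a finite
   type. *)
have [[c rcb]|nocb] := pselect (exists c, r c b); last first.
  apply: (infinite_set_noninjective _ _ chi Kinf) => j k; apply: chi_inj.
  have H l : (phi (psi l).1).1 = b.
    by have [h|[]//] := psi_k0 l; case: nocb; exists (phi (psi l).1).1.
  by rewrite !H.
apply: (amin b (phi_a k0)).
(* The values with first component [b] are moved to a second copy of [c]. *)
exists (J * I * bool)%type,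
  (fun k => if (phi (psi k).1).1 == b then (c, (chi k, true))
            else ((phi (psi k).1).1, (chi k, false))).
split=> [j k|k]; last first.
  by case: eqP => // ne; have [|[]] := psi_k0 k.
case: eqP => e1; case: eqP => e2 // [] // *; apply: chi_inj; rewrite ?e1 ?e2 //.
  by congr pair.
by congr pair.
Qed.

Lemma exists_common_transversal (X : eqType) (P : Type) (I : finType)
    (f : I -> P -> X) :
  infinite_set [set: X]%classic ->
  (forall i y, exists s : X -> P,
     (forall x, f i (s x) = y) /\ forall j, j != i -> injective (f j \o s)) ->
  exists T : P -> Prop, forall i y, exists! p, T p /\ f i p = y.
Proof.
move=> Xinf fs.
have [i0 _|I0] := pickP (@predT I); last first.
  by exists (fun=> True) => i; have := I0 i.
have Kinf : infinite_set [set: X * I]%classic.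
  move=> Kfin; apply: Xinf; rewrite -(preimage_setT (fun x => (x, i0))).
  by apply: finite_preimage => // x y _ _ [].
have [r [rwf rtot rsmall]] := exists_initial_well_order _ Kinf.
(* A stage whose value is already taken repeats an earlier pair; any other stage picks a pair with
   all values new. *)
pose Q (a : X * I) (rec : forall b, r b a -> P) p := f a.2 p = a.1 /\
  ((exists b h, p = rec b h) \/ (forall b h j, f j p <> f j (rec b h))).
have exQ a rec : exists p, Q a rec p.
  have [[b [h e]]|new] := pselect (exists b h, f a.2 (rec b h) = a.1).
    by exists (rec b h); split=> //; left; exists b, h.
  have [s [sa sinj]] := fs a.2 a.1.
  have [[x hx]|noX] := pselect (exists x, forall b h j, f j (s x) <> f j (rec b h)).
    by exists (s x); split=> //; right.
  (* Otherwise each [s x] shares a value with an earlier stage; [beta x] records that stage and the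
     index. By [new] the index is not [a.2], so [beta] is injective and [a] would be dominated. *)
  have /choice[beta hbeta] x : exists bj : (X * I) * I, exists h : r bj.1 a,
      f bj.2 (s x) = f bj.2 (rec bj.1 h).
    apply: contrapT => nbj; apply: noX; exists x => b h j e; apply: nbj.
    by exists (b, j), h.
  case: (rsmall a); exists (I * I)%type,
    (fun k => ((beta k.1).1, ((beta k.1).2, k.2))); split=> [[x i] [y j]|k] /=.
    case=> e1 e2 ->; congr pair.
    have [[h ex] [h' ey]] := (hbeta x, hbeta y).
    apply: (sinj (beta x).2) => /=.
      by apply/eqP => ji; apply: new; exists (beta x).1, h; rewrite -ji -ex ji.
    rewrite ex {2}e2 ey.
    case: (beta x) (beta y) e1 e2 h h' {ex ey} => [? ?] [? ?] /= -> -> h h'.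
    by rewrite (Prop_irrelevance h h').
  by have [] := hbeta k.1.
have [t tP] := well_founded_choice _ _ _ _ rwf exQ.
exists (fun p => exists a, p = t a) => i y.
exists (t (y, i)); split; first by split; [exists (y, i)|case: (tP (y, i))].
(* The later pair is not fresh, so it repeats that of some stage [c]; the induction then compares
   [c] with [b]. *)
have below j : forall a b, r b a -> f j (t a) = f j (t b) -> t a = t b.
  elim/(well_founded_ind rwf) => a IH b rba e.
  have [_ [[c [rca tac]]|fresh]] := tP a; last by case: (fresh b rba j e).
  rewrite tac in e *; have [rcb|->//|rbc] := rtot c b.
  - exact/esym/(IH b).
  - exact: IH.
have tinj a b j : f j (t a) = f j (t b) -> t a = t b.
  by have [rab /esym/below->|->|rba /below->] := rtot a b.
by move=> _ [[a ->] <-]; apply: (tinj _ _ i); case: (tP (f i (t a), i)).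
Qed.

Lemma unique_preimage_bijective (A B : Type) (f : A -> B) :
  (forall y, exists! x, f x = y) -> bijective f.
Proof.
move=> /choice[g gP]; exists g => [x|y]; last by case: (gP y).
by have [_] := gP (f x); apply.
Qed.

Local Open Scope group_scope.

Theorem theorem5p5 (G : groupType) (hG : infinite_set [set: G]%classic)
  (hsq : squareful G) :
  exists theta : G -> G, strong_complete_mapping theta.
Proof.
have [root [root_inj sq_inj]] : exists root : G -> G,
    injective root /\ injective (fun x => root x * root x).
  (* [phi] enumerates the squares by [G], and [root x] is a chosen square root of [phi x]. *)
  have [_ /card_esym/card_bijP[phi /bij_inj phi_inj]] := hsq.
  have /choice[root rootE] x : exists g, g ^+ 2 = val (phi (to_setT x)).
    by have /set_mem[g _ <-] := valP (phi (to_setT x)); exists g.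
  have sq_inj : injective (fun x => root x ^+ 2).
    move=> x x' /=; rewrite !rootE => /val_inj/phi_inj e.
    by have := congr1 val e.
  by exists root; split=> // x x' e; apply: sq_inj; rewrite /= e.
pose f (i : bool * bool) (p : G * G) : G := match i with
  | (false, false) => p.1
  | (false, true) => p.2
  | (true, false) => p.1^-1 * p.2
  | (true, true) => p.1 * p.2
  end.
have [|T Tuniq] := exists_common_transversal _ _ _ f hG.
  move=> [[] []] y.
  - exists (fun x => (root x, (root x)^-1 * y)); split=> [x|].
      by rewrite /= mulVKg.
    move=> [[] []] //= _ x x' /=.
    + by rewrite !mulgA => /mulIg; rewrite -!invgM => /invg_inj/sq_inj.
    + by move=> /mulIg/invg_inj/root_inj.
  - exists (fun x => (root x, root x * y)); split=> [x|]; first by rewrite /= mulKg.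
    move=> [[] []] //= _ x x' /=.
    + by rewrite !mulgA => /mulIg/sq_inj.
    + by move=> /mulIg/root_inj.
  - exists (fun x => (x, y)); split=> // -[[] []] //= _ x x' /=.
    + by move=> /mulIg.
    + by move=> /mulIg/invg_inj.
    + by [].
  - exists (fun x => (y, x)); split=> // -[[] []] //= _ x x' /=.
    + by move=> /mulgI.
    + by move=> /mulgI.
    + by [].
(* Index [(false, false)] makes [T] the graph of [theta]; the other three indices give the
   bijections. *)
have /choice[theta thetaP] g : exists h, T (g, h).
  by have [[g' h] [[Tp /= <-] _]] := Tuniq (false, false) g; exists h.
have thetaE p : T p -> p = (p.1, theta p.1).
  move=> Tp; have [q [_ uq]] := Tuniq (false, false) p.1.
  by rewrite -(uq p) ?(uq (p.1, theta p.1)).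
have bij i : bijective (fun g => f i (g, theta g)).
  apply: unique_preimage_bijective => y; have [p [[Tp fp] up]] := Tuniq i y.
  exists p.1; split=> [|g fg]; first by rewrite -thetaE.
  by rewrite (up (g, theta g)).
by exists theta; split;
  [apply: (bij (false, true))|apply: (bij (true, false))|apply: (bij (true, true))].
Qed.
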